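(* Let $C_t$ be a $t$-doped Clifford circuit on $n$ qubits written as $C_t=D^\dagger c_tDV$, with $D,V$ Clifford unitaries and $c_t$ a $t$-doped Clifford circuit acting nontrivially only on a subsystem of $t\le n$ qubits. Let the qubits be bipartitioned as $E\cup F$ with $t\le n_F$, let $Y\subset F$ be a set of $n_Y=t$ qubits, let $T_{\pi_Y}$ be a qubit-permutation unitary such that $T_{\pi_Y}c_tT_{\pi_Y}^\dagger$ acts nontrivially only on $Y$, and let $W=T_{\pi_Y}D$. Let $|\psi_t\rangle=C_t|0\rangle^{\otimes n}$, $\psi_t=|\psi_t\rangle\langle\psi_t|$, $\psi_E=\mathrm{tr}_F\psi_t$, and $$\rho:=W^\dagger\big(\mathrm{tr}_Y(W\psi_tW^\dagger)\otimes d_Y^{-1}I_Y\big)W,\qquad \rho_E=\mathrm{tr}_F\rho,\quad\rho_F=\mathrm{tr}_E\rho,$$ with $d_Y=2^{n_Y}$. Then for both $X=E$ and $X=F$, $$\mathrm{Pur}(\rho_X)\le\mathrm{Pur}(\psi_E).$$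
   Context: The system consists of $n$ qubits, $\mathcal H=(\mathbb C^2)^{\otimes n}=\mathcal H_E\otimes\mathcal H_F$, where $E,F$ consist of $n_E,n_F$ qubits, $n=n_E+n_F$. A $t$-doped Clifford circuit is a circuit of Clifford gates into which $t$ non-Clifford gates ($T$-gates) have been inserted. The purity of a state $\sigma$ is $\mathrm{Pur}(\sigma)=\mathrm{tr}(\sigma^2)$. In $\rho$, the state $\mathrm{tr}_Y(W\psi_tW^\dagger)$ lives on the complement of $Y$, and $I_Y$ is the identity on $Y$. *)

(* Defs.v *)
From HB Require Import structures.
From mathcomp Require Import all_boot all_order all_fingroup all_algebra.

Set Implicit Arguments.
Unset Strict Implicit.
Unset Printing Implicit Defensive.

Import Order.TTheory GRing.Theory Num.Theory.
Local Open Scope ring_scope.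
Local Open Scope sesquilinear_scope.

(* Qubits are labelled by a finite type I.  The computational basis of
   (C^2)^{(x) I} is the finite type [cfg I]; operators are square matrices whose
   rows and columns are numbered through [enum_rank]. *)
Definition cfg (I : finType) : finType := {ffun I -> 'I_2}.

Definition dimH (I : finType) : nat := #|cfg I|.

(* <x|M|y> *)
Definition entry (C : numClosedFieldType) (I : finType)
  (M : 'M[C]_(dimH I)) (x y : cfg I) : C :=
  M (enum_rank x) (enum_rank y).

Definition mkop (C : numClosedFieldType) (I : finType)
  (f : cfg I -> cfg I -> C) : 'M[C]_(dimH I) :=
  \matrix_(i, j) f (enum_val i) (enum_val j).

Definition ket0 (C : numClosedFieldType) (I : finType) : 'cV[C]_(dimH I) :=
  delta_mx (enum_rank ([ffun => ord0] : cfg I)) 0.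

Definition dyad (C : numClosedFieldType) (I : finType)
  (v : 'cV[C]_(dimH I)) : 'M[C]_(dimH I) :=
  v *m v ^t*.

Definition qubits (I : finType) (S : {set I}) : finType := {i : I | i \in S}.

Definition restr (I : finType) (S : {set I}) (x : cfg I) : cfg (qubits S) :=
  [ffun i => x (val i)].

(* A (x) B, where B lives on the qubits in S and A on the remaining ones. *)
Definition tens (C : numClosedFieldType) (I : finType) (S : {set I})
  (A : 'M[C]_(dimH (qubits (~: S)))) (B : 'M[C]_(dimH (qubits S))) :
  'M[C]_(dimH I) :=
  mkop (fun x y => entry A (restr (~: S) x) (restr (~: S) y) *
                   entry B (restr S x) (restr S y)).

(* tr_S : the qubits in S are traced out.  A pair (u, v) contributing to the
   (x, y) entry is u = (x, z), v = (y, z) with z a configuration of S. *)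
Definition ptrace (C : numClosedFieldType) (I : finType) (S : {set I})
  (M : 'M[C]_(dimH I)) : 'M[C]_(dimH (qubits (~: S))) :=
  mkop (fun x y =>
    \sum_(u : cfg I | restr (~: S) u == x)
      \sum_(v : cfg I | (restr (~: S) v == y) && (restr S u == restr S v))
        entry M u v).

Definition purity (C : numClosedFieldType) (m : nat) (s : 'M[C]_m) : C :=
  \tr (s *m s).

(* M acts nontrivially only on S. *)
Definition supported_on (C : numClosedFieldType) (I : finType) (S : {set I})
  (M : 'M[C]_(dimH I)) : Prop :=
  exists B : 'M[C]_(dimH (qubits S)), M = tens 1%:M B.

(* Tensor product of one single-qubit operator per qubit. *)
Definition tens_all (C : numClosedFieldType) (I : finType)
  (s : I -> 'M[C]_2) : 'M[C]_(dimH I) :=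
  mkop (fun x y => \prod_i s i (x i) (y i)).

Definition mx2 (C : numClosedFieldType) (a b c d : C) : 'M[C]_2 :=
  \matrix_(i, j) if i == 0 then (if j == 0 then a else b)
                           else (if j == 0 then c else d).

Definition pauli1 (C : numClosedFieldType) (k : 'I_4) : 'M[C]_2 :=
  tnth [tuple 1%:M; mx2 0 1 1 0; mx2 0 (- 'i) 'i 0; mx2 1 0 0 (- 1)] k.

Definition pauli_group (C : numClosedFieldType) (I : finType)
  (P : 'M[C]_(dimH I)) : Prop :=
  exists (k : nat) (p : {ffun I -> 'I_4}),
    P = 'i ^+ k *: tens_all (fun i => pauli1 C (p i)).

(* The Clifford group as the normaliser of the (finite) Pauli group in the
   unitary group, hence including all global phases. *)
Definition clifford (C : numClosedFieldType) (I : finType)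
  (U : 'M[C]_(dimH I)) : Prop :=
  U \is unitarymx /\
  forall P : 'M[C]_(dimH I), pauli_group P -> pauli_group (U *m P *m U ^t*).

(* diag(1, e^{i pi/4}) *)
Definition Tgate1 (C : numClosedFieldType) : 'M[C]_2 :=
  mx2 1 0 0 ((1 + 'i) / sqrtC 2).

Definition Tgate (C : numClosedFieldType) (I : finType) (q : I) :
  'M[C]_(dimH I) :=
  tens_all (fun i => if i == q then Tgate1 C else 1%:M).

(* [doped t U]: U is the unitary of a circuit made of Clifford gates and of
   exactly t T-gates, applied in any order. *)
Inductive doped (C : numClosedFieldType) (I : finType) :
  nat -> 'M[C]_(dimH I) -> Prop :=
| doped_id : doped 0 1%:M
| doped_clifford (t : nat) (G U : 'M[C]_(dimH I)) :
    clifford G -> doped t U -> doped t (G *m U)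
| doped_T (t : nat) (q : I) (U : 'M[C]_(dimH I)) :
    doped t U -> doped t.+1 (Tgate C q *m U).

(* T_pi |x> = |x o pi^-1> : the content of qubit i is moved to qubit pi i. *)
Definition perm_op (C : numClosedFieldType) (I : finType) (pi : {perm I}) :
  'M[C]_(dimH I) :=
  mkop (fun y x => (y == [ffun i => x ((pi^-1)%g i)])%:R).

(* Main.v *)
(** Expanding the swap operator in Pauli strings gives
    [2 ^ |~: S| * Pur (tr_S M) = \sum_P tr (P M) ^ 2], over the Pauli strings [P]
    that are trivial on [S].  Since [W] is Clifford, [W P W^*] is a Pauli string
    [Q] up to a phase, and [tr (P rho)] equals [tr (P psi)] when [Q] is trivial
    on [Y] and vanishes otherwise.  As [tr (P psi)] is real, the expansion of
    [Pur (rho_X)] is dominated termwise by that of [Pur (psi_X)], and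
    [Pur (psi_E) = Pur (psi_F)] because [psi] is pure. *)

Require Import Defs.
From HB Require Import structures.
From mathcomp Require Import all_boot all_order all_fingroup all_algebra.
From mathcomp.real_closed Require Import complex.
From mathcomp Require Import reals ring.

Import Order.TTheory GRing.Theory Num.Theory.
Local Open Scope ring_scope.
Local Open Scope sesquilinear_scope.

Section Operators.
Variables (C : numClosedFieldType) (I : finType).
Implicit Types (M : 'M[C]_(dimH I)) (S Y : {set I}) (p q : {ffun I -> 'I_4}).

(** * Operators through their entries in the computational basis *)

Lemma entry_mkop (J : finType) (f : cfg J -> cfg J -> C) x y :
  entry (mkop f) x y = f x y.
Proof. by rewrite /entry mxE !enum_rankK. Qed.

Lemma sum_enum_rank (T : finType) (f : 'I_#|T| -> C) :
  \sum_i f i = \sum_(x : T) f (enum_rank x).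
Proof. by rewrite (reindex enum_rank) //; apply: onW_bij; apply: enum_rank_bij. Qed.

Lemma entry_mul (J : finType) (M N : 'M[C]_(dimH J)) x y :
  entry (M *m N) x y = \sum_z entry M x z * entry N z y.
Proof. by rewrite /entry mxE sum_enum_rank. Qed.

Lemma entry_inj (J : finType) (M N : 'M[C]_(dimH J)) :
  (forall x y, entry M x y = entry N x y) -> M = N.
Proof.
move=> eqMN; apply/matrixP=> i j.
by have := eqMN (enum_val i) (enum_val j); rewrite /entry !enum_valK.
Qed.

Lemma entry_adj (J : finType) (M : 'M[C]_(dimH J)) x y :
  entry (M ^t*) x y = (entry M y x)^*.
Proof. by rewrite /entry !mxE. Qed.

Lemma trace_mul (J : finType) (M N : 'M[C]_(dimH J)) :
  \tr (M *m N) = \sum_x \sum_y entry M x y * entry N y x.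
Proof.
by rewrite /mxtrace sum_enum_rank; apply: eq_bigr => x _; rewrite -entry_mul.
Qed.

Lemma entry_tens S (A : 'M[C]_(dimH (qubits (~: S)))) (B : 'M[C]_(dimH (qubits S))) x y :
  entry (tens A B) x y =
  entry A (restr (~: S) x) (restr (~: S) y) * entry B (restr S x) (restr S y).
Proof. exact: entry_mkop. Qed.

Lemma restr_eqE S (u v : cfg I) :
  (restr S u == restr S v) = [forall i, (i \in S) ==> (u i == v i)].
Proof.
apply/eqP/forallP => [/ffunP uv i|uv].
  by apply/implyP => iS; have := uv (exist _ i iS); rewrite !ffunE => /eqP.
by apply/ffunP => -[i iS]; rewrite !ffunE; apply/eqP; move/implyP: (uv i); apply.
Qed.

(** As a product of indicators, a condition imposed on every qubit lets sums over configurations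
    factor qubit by qubit. *)
Lemma natr_forall (b : pred I) : [forall i, b i]%:R = \prod_i (b i)%:R :> C.
Proof.
case: forallP => [bT|/forallP].
  by rewrite big1 // => i _; rewrite bT.
by rewrite negb_forall => /existsP [i /negbTE bi]; rewrite (bigD1 i) //= bi mul0r.
Qed.

Lemma sum2_prod (f : I -> 'I_2 -> 'I_2 -> C) :
  \sum_(x : cfg I) \sum_(y : cfg I) \prod_i f i (x i) (y i) =
  \prod_i \sum_a \sum_b f i a b.
Proof.
rewrite bigA_distr_bigA; apply: eq_bigr => x _.
by rewrite bigA_distr_bigA.
Qed.

(** * Pauli strings, the swap kernel and purities of partial traces *)

Definition pauli_string p : 'M[C]_(dimH I) := tens_all (fun i => pauli1 C (p i)).

Lemma entry_pauli p x y :
  entry (pauli_string p) x y = \prod_i pauli1 C (p i) (x i) (y i).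
Proof. exact: entry_mkop. Qed.

Lemma sum_pauli (f : 'I_4 -> C) : \sum_k f k = f 0 + f 1 + f 2%:R + f 3%:R.
Proof.
rewrite !big_ord_recr big_ord0 /= add0r.
by congr (f _ + f _ + f _ + f _); apply: val_inj.
Qed.

Lemma pauli1E (k : 'I_4) (a b : 'I_2) :
  pauli1 C k a b = [:: (a == b)%:R; (a != b)%:R;
     if a == b then 0 else if a == 0 then - 'i else 'i;
     if a != b then 0 else if a == 0 then 1 else - 1]`_k.
Proof.
rewrite /pauli1 (tnth_nth 0).
by case: k => [] [|[|[|[|//]]]] ? /=; rewrite mxE //; case: a => [] [|[|//]] ?;
  case: b => [] [|[|//]] ?; rewrite -!val_eqE.
Qed.

(* The Pauli expansion of the one-qubit swap. *)
Lemma pauli1_swap (a b c d : 'I_2) :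
  \sum_k pauli1 C k a b * pauli1 C k c d = 2 * ((a == d) && (b == c))%:R.
Proof.
have i2 : 'i * 'i = -1 :> C by rewrite -expr2 sqrCi.
rewrite sum_pauli !pauli1E.
case: a => [] [|[|//]] ?; case: b => [] [|[|//]] ?;
case: c => [] [|[|//]] ?; case: d => [] [|[|//]] ?;
rewrite -!val_eqE /= ?mulrNN ?mulNr ?mulrN ?i2; ring.
Qed.

Lemma pauli1_tr (k : 'I_4) : \sum_a pauli1 C k a a = (k == 0)%:R *+ 2.
Proof.
rewrite !big_ord_recr big_ord0 /= add0r !pauli1E.
by case: k => [] [|[|[|[|//]]]] ?; rewrite -!val_eqE /=; ring.
Qed.

Lemma pauli1_conj (k : 'I_4) (a b : 'I_2) : (pauli1 C k a b)^* = pauli1 C k b a.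
Proof.
rewrite !pauli1E.
by case: k => [] [|[|[|[|//]]]] ?; case: a => [] [|[|//]] ?;
  case: b => [] [|[|//]] ?; rewrite -!val_eqE /= ?rmorphN /= ?conjCi ?rmorph0 ?rmorph1 ?opprK.
Qed.

(* The kernel of the operator swapping the complement of [S] between two copies. *)
Definition swap_ker S (u v u' v' : cfg I) : bool :=
  [forall i, if i \in S then (u i == v i) && (u' i == v' i)
             else (u i == v' i) && (v i == u' i)].

Lemma swap_kerE S u v u' v' :
  swap_ker S u v u' v' =
  [&& restr (~: S) u == restr (~: S) v', restr (~: S) v == restr (~: S) u',
      restr S u == restr S v & restr S u' == restr S v'].
Proof.
rewrite !restr_eqE; apply/forallP/and4P => [H|[/forallP a /forallP b /forallP c /forallP d] i].
  by split; apply/forallP => i; have := H i; rewrite ?inE; case: ifP => //= _ /andP [].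
by move: (a i) (b i) (c i) (d i); rewrite inE; case: (i \in S) => /= [_ _|] -> ->.
Qed.


(** Turning the constraints into a 0/1 weight leaves a free index pair [w], so that later sums can
    be exchanged. *)
Lemma entry_ptrace S M x y :
  entry (ptrace S M) x y = \sum_(w : cfg I * cfg I)
    [&& restr (~: S) w.1 == x, restr (~: S) w.2 == y &
        restr S w.1 == restr S w.2]%:R * entry M w.1 w.2.
Proof.
rewrite entry_mkop -(pair_bigA _ (fun u v =>
  [&& restr (~: S) u == x, restr (~: S) v == y & restr S u == restr S v]%:R
    * entry M u v)) /= big_mkcond; apply: eq_bigr => u _.
case: eqP => _ /=; last by rewrite big1 // => v _; rewrite mul0r.
by rewrite big_mkcond; apply: eq_bigr => v _; case: ifP; rewrite ?mul1r ?mul0r.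
Qed.

(** The swap trick: the trace of a square is the trace of two copies against their swap, and tracing
    out [S] replaces the swap by the identity on [S]. *)
Lemma purity_ptrace S M :
  purity (ptrace S M) = \sum_(w : cfg I * cfg I) \sum_(w' : cfg I * cfg I)
    (swap_ker S w.1 w.2 w'.1 w'.2)%:R * (entry M w.1 w.2 * entry M w'.1 w'.2).
Proof.
rewrite /purity trace_mul pair_bigA /=.
under eq_bigr => z _ do rewrite !entry_ptrace big_distrlr /=.
rewrite exchange_big; apply: eq_bigr => w _.
rewrite exchange_big; apply: eq_bigr => w' _ /=.
(* The constraints determine the summed pair [(x, y)] as the restrictions of [w.1] and [w.2]. *)
rewrite swap_kerE (bigD1 (restr (~: S) w.1, restr (~: S) w.2)) //= !eqxx /=.
rewrite big1 => [|[x y] /= neq].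
  rewrite addr0 mulrACA -natrM mulnb [_ w'.1 == _ w.2]eq_sym [_ w'.2 == _ w.1]eq_sym.
  congr (_%:R * _); case: (restr S w.1 == _) => //=; rewrite ?andbF //.
  by rewrite andbCA.
rewrite mulrACA -natrM mulnb.
case: eqP => [ex|_]; last by rewrite mul0r.
case: eqP => [ey|_]; last by rewrite mul0r.
by rewrite ex ey eqxx in neq.
Qed.

Lemma trace_mul_pauli p M :
  \tr (pauli_string p *m M) = \sum_(w : cfg I * cfg I)
    (\prod_i pauli1 C (p i) (w.2 i) (w.1 i)) * entry M w.1 w.2.
Proof.
rewrite trace_mul exchange_big pair_bigA; apply: eq_bigr => w _ /=.
by rewrite entry_pauli.
Qed.

(** The swap kernel is a product over qubits. Outside [S], twice the one-qubit swap is a sum over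
    all four Paulis; inside [S], the identity Pauli alone gives the kernel. *)
Lemma purity_pauli S M :
  2 ^+ #|~: S| * purity (ptrace S M) =
  \sum_(p in family (fun i => [pred k : 'I_4 | (i \in S) ==> (k == 0)]))
     \tr (pauli_string p *m M) ^+ 2.
Proof.
under eq_bigr => p _ do rewrite trace_mul_pauli expr2 big_distrlr /=.
rewrite purity_ptrace mulr_sumr exchange_big; apply: eq_bigr => -[u v] _ /=.
rewrite mulr_sumr exchange_big; apply: eq_bigr => -[u' v'] _ /=.
under eq_bigr => p _ do rewrite mulrACA -big_split /=.
rewrite -mulr_suml mulrA; congr (_ * _).
rewrite -(bigA_distr_big_dep (fun i => [pred k : 'I_4 | (i \in S) ==> (k == 0)])
  (fun i k => pauli1 C k (v i) (u i) * pauli1 C k (v' i) (u' i))).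
rewrite natr_forall -prodr_const big_mkcond -big_split /=; apply: eq_bigr => i _.
rewrite inE; case: (i \in S) => /=.
  rewrite big_pred1_eq !pauli1E mul1r -natrM mulnb.
  by rewrite (eq_sym (v i)) (eq_sym (v' i)).
by rewrite pauli1_swap andbC.
Qed.

Lemma entry_dyad (a : 'cV[C]_(dimH I)) x y :
  entry (dyad a) x y = a (enum_rank x) 0 * (a (enum_rank y) 0)^*.
Proof. by rewrite /entry mxE big_ord1 !mxE. Qed.

Lemma purity_dyad S (a : 'cV[C]_(dimH I)) :
  purity (ptrace (~: S) (dyad a)) = purity (ptrace S (dyad a)).
Proof.
(* For a pure state, exchanging the column indices of the two copies of [dyad a]
   leaves the product of their entries unchanged, and turns [S] into [~: S]. *)
pose sw (z : (cfg I * cfg I) * (cfg I * cfg I)) :=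
  ((z.1.1, z.2.2), (z.2.1, z.1.2)).
have swK : involutive sw by case=> [[? ?] [? ?]].
rewrite !purity_ptrace !pair_bigA (reindex_inj (inv_inj swK)) /=.
apply: eq_bigr => -[[u v] [u' v']] _ /=; rewrite !entry_dyad.
congr (_%:R * _); last by ring.
congr (nat_of_bool _); apply: eq_forallb => i; rewrite inE.
by case: (i \in S) => /=; rewrite [u' i == _]eq_sym.
Qed.

(** The trace factors over qubits: a maximally mixed qubit of [S] contributes half the trace of its
    Pauli, which vanishes unless that Pauli is the identity. *)
Lemma tr_pauli_depol S p M :
  \tr (pauli_string p *m tens (ptrace S M) ((2 ^ #|S|)%:R^-1 *: 1%:M)) =
  [forall i, (i \in S) ==> (p i == 0)]%:R * \tr (pauli_string p *m M).
Proof.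
rewrite trace_mul trace_mul_pauli mulr_sumr.
under eq_bigr => x _ do under eq_bigr => y _ do
  rewrite entry_tens entry_ptrace mulr_suml mulr_sumr.
under eq_bigr => x _ do rewrite exchange_big.
rewrite exchange_big; apply: eq_bigr => -[u v] _ /=.
rewrite natr_forall mulrA -big_split /=.
(* [f i] is the factor of qubit [i] for a fixed entry [(u, v)] of [M]; the normalization is spread
   as one division by 2 for each qubit of [S]. *)
pose f i (a b : 'I_2) := pauli1 C (p i) a b *
  (if i \in S then (u i == v i)%:R * (a == b)%:R / 2
   else ((u i == b) && (v i == a))%:R).
transitivity ((\sum_(x : cfg I) \sum_(y : cfg I) \prod_i f i (x i) (y i)) * entry M u v).
  rewrite mulr_suml; apply: eq_bigr => x _; rewrite mulr_suml; apply: eq_bigr => y _.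
  rewrite entry_pauli /f big_split /= -!mulrA; congr (_ * _).
  rewrite mulrCA [RHS]mulrC; congr (_ * _).
  have -> : (2 ^ #|S|)%:R^-1 = \prod_i (if i \in S then 2^-1 else 1) :> C.
    by rewrite -big_mkcond prodr_const natrX exprVn.
  rewrite /entry !mxE (inj_eq enum_rank_inj) !restr_eqE !andbA.
  rewrite -!mulnb !natrM !natr_forall -!big_split; apply: eq_bigr => i _ /=.
  rewrite inE [y i == _]eq_sym; case: (i \in S) => /=; last first.
    by rewrite -mulnb natrM !mulr1.
  by rewrite !mul1r [2^-1 * _]mulrC mulrA.
rewrite sum2_prod; congr (_ * _); apply: eq_bigr => i _.
rewrite /f; case: (i \in S) => /=.
  transitivity ((u i == v i)%:R / 2 * \sum_a pauli1 C (p i) a a).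
    rewrite mulr_sumr; apply: eq_bigr => a _.
    rewrite (bigD1 a) //= eqxx big1 => [|b]; first by rewrite mulr1 addr0 mulrC.
    by rewrite eq_sym => /negbTE ->; rewrite mulr0 mul0r mulr0.
  rewrite pauli1_tr; case: (p i =P 0) => [->|_]; last by rewrite mul0rn mulr0 mul0r.
  by rewrite pauli1E /= [v i == _]eq_sym mul1r divfK ?pnatr_eq0.
(* Outside [S], only [a = v i] and [b = u i] contribute. *)
rewrite (bigD1 (v i)) //= [X in _ + X]big1 => [|a]; last first.
  by rewrite eq_sym => /negbTE ->; rewrite big1 // => b _; rewrite andbF mulr0.
rewrite (bigD1 (u i)) //= big1 => [|b]; last first.
  by rewrite eq_sym => /negbTE ->; rewrite mulr0.
by rewrite !eqxx !addr0 mulr1 mul1r.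
Qed.

(** Both operators are Hermitian, so conjugation only exchanges the two summed indices. Realness
    makes the squares in the Pauli expansion nonnegative. *)
Lemma tr_pauli_dyad_real p (a : 'cV[C]_(dimH I)) :
  \tr (pauli_string p *m dyad a) \is Num.real.
Proof.
apply/CrealP; rewrite trace_mul rmorph_sum /=.
under eq_bigr => x _ do rewrite rmorph_sum /=.
rewrite exchange_big; apply: eq_bigr => x _; apply: eq_bigr => y _ /=.
rewrite !entry_pauli !entry_dyad !rmorphM /= conjCK rmorph_prod /=.
under eq_bigr => i _ do rewrite pauli1_conj.
by congr (_ * _); rewrite mulrC.
Qed.

(** * Qubit permutations acting on Pauli strings *)

Lemma entry_perm_op (s : {perm I}) y x :
  entry (perm_op C s) y x = (y == [ffun i => x ((s^-1)%g i)])%:R.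
Proof. exact: entry_mkop. Qed.

Lemma perm_op_unitary (s : {perm I}) : perm_op C s \is unitarymx.
Proof.
apply/unitarymxP/mulmx1C/entry_inj => x y; rewrite entry_mul.
rewrite (bigD1 [ffun i => x ((s^-1)%g i)]) //= big1 => [|z /negbTE neq].
  rewrite addr0 entry_adj !entry_perm_op eqxx conjC1 mul1r /entry mxE.
  rewrite (inj_eq enum_rank_inj); congr (nat_of_bool _)%:R.
  apply/eqP/eqP => [/ffunP eqxy|-> //]; apply/ffunP => i.
  by have := eqxy (s i); rewrite !ffunE permK.
by rewrite entry_adj !entry_perm_op neq conjC0 mul0r.
Qed.

(** A qubit permutation relabels the tensor factors without any phase. Unitarity reduces this to an
    intertwining relation free of adjoints. *)
Lemma perm_op_pauli (s : {perm I}) p :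
  perm_op C s *m pauli_string p *m (perm_op C s) ^t* =
  pauli_string [ffun i => p ((s^-1)%g i)].
Proof.
set q := [ffun _ => _].
suff -> : perm_op C s *m pauli_string p = pauli_string q *m perm_op C s.
  by rewrite mulmxtVK ?perm_op_unitary.
apply: entry_inj => y x; rewrite !entry_mul.
(* One middle index survives on each side: [y] composed with [s] on the left, [x] composed with the
   inverse of [s] on the right. *)
rewrite (bigD1 [ffun i => y (s i)]) //= big1 => [|z]; last first.
  rewrite entry_perm_op; case: (y =P _) => [->|]; last by rewrite mul0r.
  by case/eqP; apply/ffunP => i; rewrite !ffunE permK.
rewrite [RHS](bigD1 [ffun i => x ((s^-1)%g i)]) //= [in RHS]big1 => [|z /negbTE neq]; last first.
  by rewrite entry_perm_op neq mulr0.
rewrite !addr0 !entry_pauli !entry_perm_op eqxx mulr1.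
rewrite (_ : y == _) ?mul1r; last first.
  by apply/eqP/ffunP => i; rewrite !ffunE permKV.
rewrite [RHS](reindex_inj (@perm_inj _ s)); apply: eq_bigr => i _.
by rewrite !ffunE permK.
Qed.

(** * Purity after complete depolarization of [Y] *)

Definition depol Y (M : 'M[C]_(dimH I)) : 'M[C]_(dimH I) :=
  tens (ptrace Y M) ((2 ^ #|Y|)%:R^-1 *: 1%:M).

(** The factor [2 ^+ #|~: S|] is common to both expansions, so a termwise bound suffices. *)
Lemma le_purity_pauli S (M N : 'M[C]_(dimH I)) :
  (forall p, \tr (pauli_string p *m M) ^+ 2 <= \tr (pauli_string p *m N) ^+ 2) ->
  purity (ptrace S M) <= purity (ptrace S N).
Proof.
move=> leMN; have pos2 : 0 < 2 ^+ #|~: S| :> C by rewrite exprn_gt0 // ltr0n.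
by rewrite -(ler_pM2l pos2) !purity_pauli; apply: ler_sum.
Qed.

Lemma purity_depol_le S Y (W : 'M[C]_(dimH I)) (a : 'cV[C]_(dimH I)) :
  W \is unitarymx ->
  (forall p, pauli_group (W *m pauli_string p *m W ^t*)) ->
  purity (ptrace S (W ^t* *m depol Y (W *m dyad a *m W ^t*) *m W)) <=
  purity (ptrace S (dyad a)).
Proof.
move=> /unitarymxP /mulmx1C WK WP; apply: le_purity_pauli => p.
(* Cyclicity of the trace moves the conjugation from the state to the Pauli string. *)
have trWE (M : 'M[C]_(dimH I)) : \tr (pauli_string p *m (W ^t* *m M *m W)) =
    \tr (W *m pauli_string p *m W ^t* *m M).
  by rewrite mulmxA mxtrace_mulC !mulmxA.
have pos : 0 <= \tr (pauli_string p *m dyad a) ^+ 2.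
  by rewrite real_exprn_even_ge0 ?tr_pauli_dyad_real.
set N := W *m dyad a *m W ^t*.
have psiE : dyad a = W ^t* *m N *m W.
  by rewrite !mulmxA WK mul1mx -mulmxA WK mulmx1.
(* The same phase ['i ^+ k] enters both squares, so either they agree, or the left one is 0 and
   [pos] concludes. *)
move: pos; rewrite psiE !trWE; have [k [q ->]] := WP p.
rewrite -!scalemxAl !linearZ /= -/(pauli_string q) tr_pauli_depol.
by case: [forall i, _] => pos; rewrite ?mul1r // mul0r mulr0 expr0n.
Qed.

End Operators.

Arguments pauli_string C {I} p.

Local Open Scope complex_scope.

Theorem proposition3 (R : realType) (n t : nat) (ht : (t <= n)%N)
  (Ct ct D V : 'M[R[i]]_(dimH 'I_n))
  (hCt : doped t Ct)
  (hD : clifford D) (hV : clifford V)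
  (hct : doped t ct)
  (A : {set 'I_n}) (hA : #|A| = t) (hctA : supported_on A ct)
  (hdec : Ct = D ^t* *m ct *m D *m V)
  (E F : {set 'I_n}) (hEF : E :|: F = [set: 'I_n]) (hdisj : [disjoint E & F])
  (htF : (t <= #|F|)%N)
  (Y : {set 'I_n}) (hYF : Y \subset F) (hY : #|Y| = t)
  (piY : {perm 'I_n})
  (hpiY : supported_on Y (perm_op R[i] piY *m ct *m (perm_op R[i] piY) ^t*)) :
  let W := perm_op R[i] piY *m D in
  let psi := dyad (Ct *m ket0 R[i] 'I_n) in
  let dY : R[i] := (2 ^ #|Y|)%:R in
  let rho :=
    W ^t* *m tens (ptrace Y (W *m psi *m W ^t*)) (dY^-1 *: 1%:M) *m W in
  purity (ptrace F rho) <= purity (ptrace F psi) /\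
  purity (ptrace E rho) <= purity (ptrace F psi).
Proof.
move=> W psi dY rho.
have [Duni Dpauli] := hD.
have Wuni : W \is unitarymx by rewrite mul_unitarymx ?perm_op_unitary.
have WP p : pauli_group (W *m pauli_string R[i] p *m W ^t*).
  have Pp : pauli_group (pauli_string R[i] p).
    by exists 0, p; rewrite expr0 scale1r.
  have [k [q DpE]] := Dpauli _ Pp.
  (* [D] yields the string [q] and the phase; the permutation then moves the letters of [q] along
     [piY]. *)
  exists k, [ffun i => q ((piY^-1)%g i)].
  rewrite -/(pauli_string R[i] _) -perm_op_pauli scalemxAl scalemxAr -DpE.
  by rewrite trmx_mul map_mxM !mulmxA.
have EF : E = ~: F.
  apply/setP => i; rewrite inE; have /setP /(_ i) := hEF; rewrite !inE.
  by have [iF|iF] := boolP (i \in F); rewrite ?orbT ?orbF // (disjointFl hdisj).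
split; first exact: purity_depol_le.
(* The state [psi] is pure, so its two marginals have the same purity; the bound is then an instance
   with [E] traced out on both sides. *)
rewrite -(purity_dyad _ _ F) EF; exact: purity_depol_le.
Qed.
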